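(* Let $(M,\Phi,E_+,E_-,G)$ be a normal generalized contact metric structure, let $\pi_M$ be the canonical Poisson structure on $M$, and let $\eta=pr_{T^*M}E_++pr_{T^*M}E_-$. Let $\mathbb R$ (with coordinate $t$) carry its standard normal generalized contact metric structure $\left(\Phi_{\mathbb R}=0,\ dt,\ \frac{\partial}{\partial t},\ G_{\mathbb R}=\begin{pmatrix}0&(dt^2)^{-1}\\ dt^2&0\end{pmatrix}\right)$, whose underlying Poisson structure is $\pi_{\mathbb R}=0$, and let $\pi=\pi_M+\pi_{\mathbb R}$ be the product Poisson structure on $M\times\mathbb R$. Let $B=d(e^t\eta)$ and $\widehat B=d\eta$. Then $I+B\pi$ is invertible as a map from $T^*(M\times\mathbb R)$ to $T^*(M\times\mathbb R)$ if and only if $I+e^t\widehat B\pi_M$ is invertible as a map from $T^*M$ to $T^*M$ for all $t\in\mathbb R$.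
   Context: On $TM\oplus T^*M$ use the neutral metric $\langle X+\alpha,Y+\beta\rangle=\frac12(\beta(X)+\alpha(Y))$ and the Courant bracket $[[X+\alpha,Y+\beta]]=[X,Y]+\mathcal L_X\beta-\mathcal L_Y\alpha-\frac12 d(\iota_X\beta-\iota_Y\alpha)$. Adjoints are taken with respect to $\langle\cdot,\cdot\rangle$, and $(E\otimes F)(u)=2\langle F,u\rangle E$. A two-form is viewed as a map from tangent to cotangent bundle by interior product, a bivector as a map from cotangent to tangent bundle, and $B\pi$ is the composition. A generalized almost contact structure on $M$ is a triple $(\Phi,E_\pm)$ with $\Phi$ an endomorphism of $TM\oplus T^*M$ and $E_\pm$ sections of $TM\oplus T^*M$ such that $\Phi+\Phi^*=0$, $\Phi\circ\Phi=-Id+E_+\otimes E_-+E_-\otimes E_+$, $\langle E_\pm,E_\pm\rangle=0$, $2\langle E_+,E_-\rangle=1$. Let $E^{(1,0)}$, $E^{(0,1)}$ be the $\pm\sqrt{-1}$ eigenbundles of $\Phi$ in $(TM\oplus T^*M)\otimes\mathbb C$, $L_{E_\pm}$ the line bundle spanned by $E_\pm$, and $L^\pm=L_{E_\pm}\oplus E^{(1,0)}$. The structure is strong if both $L^+$ and $L^-$ are closed under the Courant bracket, and is a normal generalized contact structure if it is strong and $[[E_+,E_-]]=0$. A generalized metric is an automorphism $G$ of $TM\oplus T^*M$ with $G^*=G$, $G^2=1$ and $\langle G\cdot,\cdot\rangle$ positive definite. The structure together with $G$ is a generalized (almost) contact metric structure if $-\Phi G\Phi=G-E_+\otimes E_+-E_-\otimes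 E_-$. Canonical Poisson structure: with $e_\pm=pr_{TM}E_\pm$, put $\pi_M=\pi_0+e_+\wedge e_-$. Here, locally, $E^{(1,0)}\oplus E^{(0,1)}=(E_+\oplus E_-)^\perp\otimes\mathbb C$ is identified with $T_{\mathbb C}W\oplus T^*_{\mathbb C}W$ for a transversal $W$ to the foliation generated by $e_+,e_-$, $\Phi$ restricts there to a generalized complex structure, and $\pi_0$ is the canonical Poisson bivector of that generalized complex structure extended to $M$. The canonical Poisson bivector of a generalized complex structure $\mathcal J$ is the $T^*\to T$ component of $\mathcal J$; since $\Phi$ vanishes on $E_\pm$, the extension of $\pi_0$ to $M$ is the $T^*M\to TM$ component of $\Phi$, $\pi_0(\alpha)=pr_{TM}(\Phi\alpha)$. *)

(* Defs.v *)
From HB Require Import structures.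
From mathcomp Require Import all_boot all_order all_algebra.
From mathcomp Require Import all_classical all_reals all_analysis.
From mathcomp Require Import complex.

Set Implicit Arguments.
Unset Strict Implicit.
Unset Printing Implicit Defensive.

Import Order.TTheory GRing.Theory Num.Theory.
Import numFieldNormedType.Exports.

Local Open Scope classical_set_scope.
Local Open Scope ring_scope.

Fixpoint Ck (R : realType) (n k : nat) (U : set 'rV[R]_n) (f : 'rV[R]_n -> R)
  : Prop :=
  (forall x, U x -> {for x, continuous f}) /\
  if k is k'.+1 then
    forall a : 'I_n, (forall x, U x -> derivable f x (delta_mx 0 a)) /\
                     Ck k' U ('D_(delta_mx 0 a) f)
  else True.

Definition smooth_on (R : realType) (n : nat) (U : set 'rV[R]_n)
  (f : 'rV[R]_n -> R) : Prop := forall k, Ck k U f.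

(* [crd c] and [par c] are total functions; only their restrictions to
   [cdom c] and to its image [crd c @` cdom c] are meaningful. *)
Record manifold (R : realType) (n : nat) := Manifold {
  mcar :> topologicalType;
  m_hausdorff : hausdorff_space mcar;
  m_second_countable : @second_countable mcar;
  chart : Type;
  cdom : chart -> set mcar;
  crd : chart -> mcar -> 'rV[R]_n;
  par : chart -> 'rV[R]_n -> mcar;
  cdom_open : forall c, open (cdom c);
  cimg_open : forall c, open (crd c @` cdom c);
  crdK : forall c p, cdom c p -> par c (crd c p) = p;
  crd_continuous : forall c p, cdom c p -> {for p, continuous (crd c)};
  par_continuous : forall c x, (crd c @` cdom c) x ->
    {for x, continuous (par c)};
  chart_cover : forall p, exists c, cdom c p;
  transition_smooth : forall c d b,
    smooth_on (crd c @` (cdom c `&` cdom d)) (fun x => crd d (par c x) 0 b)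
}.

Section SmoothComposition.
Variables (R : realType) (m : nat).

Lemma derive_lin (V : normedModType R) (L : V -> 'rV[R]_m)
  (HL : linear L) (g : 'rV[R]_m -> R) (x v : V) :
  'D_v (g \o L) x = 'D_(L v) g (L x).
Proof.
rewrite /derive.
suff -> : (fun h : R => h^-1 *: (((g \o L) \o shift x) (h *: v) - (g \o L) x))
  = (fun h : R => h^-1 *: ((g \o shift (L x)) (h *: L v) - g (L x))) by [].
by apply/funext => h /=; rewrite HL.
Qed.

Lemma derivable_lin (V : normedModType R) (L : V -> 'rV[R]_m)
  (HL : linear L) (g : 'rV[R]_m -> R) (x v : V) :
  derivable g (L x) (L v) -> derivable (g \o L) x v.
Proof.
rewrite /derivable => Hc.
suff -> : (fun h : R => h^-1 *: (((g \o L) \o shift x) (h *: v) - (g \o L) x))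
  = (fun h : R => h^-1 *: ((g \o shift (L x)) (h *: L v) - g (L x))) by [].
by apply/funext => h /=; rewrite HL.
Qed.

Lemma Ck_cst n k (U : set 'rV[R]_n) (a : R) : Ck k U (cst a).
Proof.
elim: k a => [|k IH] a; (split; first by move=> x _; exact: cst_continuous).
  by [].
move=> i; split; first by move=> x _; exact: derivable_cst.
have -> : 'D_(delta_mx 0 i) (cst a) = cst 0 :> ('rV[R]_n -> R).
  by apply/funext => x; exact: derive_cst.
exact: IH.
Qed.

Lemma Ck_lin (n k : nat) (L : 'rV[R]_n -> 'rV[R]_m)
    (U : set 'rV[R]_m) (V : set 'rV[R]_n) (f : 'rV[R]_m -> R) :
  linear L -> continuous L ->
  (forall a, (exists b, L (delta_mx 0 a) = delta_mx 0 b) \/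
             L (delta_mx 0 a) = 0) ->
  (forall x, V x -> U (L x)) -> Ck k U f -> Ck k V (f \o L).
Proof.
move=> Llin Lc Lb VU; elim: k f => [|k IH] f [fc fd]; split => //.
- by move=> x Vx; apply: continuous_comp; [exact: Lc|exact: fc (VU _ Vx)].
- by move=> x Vx; apply: continuous_comp; [exact: Lc|exact: fc (VU _ Vx)].
move=> a; have [[b Eb]|E0] := Lb a.
  have [fdb Cb] := fd b; split.
    by move=> x Vx; apply: derivable_lin => //; rewrite Eb; exact: fdb (VU _ Vx).
  have -> : 'D_(delta_mx 0 a) (f \o L) = ('D_(delta_mx 0 b) f) \o L.
    by apply/funext => x; rewrite derive_lin // Eb.
  exact: IH.
split.
  by move=> x Vx; apply: derivable_lin => //; rewrite E0; exact: derivable0.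
have -> : 'D_(delta_mx 0 a) (f \o L) = cst 0.
  by apply/funext => x; rewrite derive_lin // E0 derive0.
exact: Ck_cst.
Qed.

End SmoothComposition.

Section ProductManifold.
Variables (R : realType) (m n : nat) (M : manifold R m) (N : manifold R n).

Local Notation MN := (M * N)%type.

Let pdom (c : chart M * chart N) : set MN := cdom c.1 `*` cdom c.2.
Let pcrd (c : chart M * chart N) (p : MN) : 'rV[R]_(m + n) :=
  row_mx (crd c.1 p.1) (crd c.2 p.2).
Let ppar (c : chart M * chart N) (x : 'rV[R]_(m + n)) : MN :=
  (par c.1 (lsubmx x), par c.2 (rsubmx x)).

Lemma prod_hausdorff : hausdorff_space MN.
Proof.
move=> p q pq; apply/injective_projections.
- apply: m_hausdorff => A B pA qB.
  have [] := pq (fst @^-1` A) (fst @^-1` B).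
  + exact: (cvg_fst (F := nbhs p.1) (G := nbhs p.2)).
  + exact: (cvg_fst (F := nbhs q.1) (G := nbhs q.2)).
  by move=> z [Az Bz]; exists z.1.
- apply: m_hausdorff => A B pA qB.
  have [] := pq (snd @^-1` A) (snd @^-1` B).
  + exact: (cvg_snd (F := nbhs p.1) (G := nbhs p.2)).
  + exact: (cvg_snd (F := nbhs q.1) (G := nbhs q.2)).
  by move=> z [Az Bz]; exists z.2.
Qed.

Lemma openX (T S : topologicalType) (A : set T) (B : set S) :
  open A -> open B -> open (A `*` B).
Proof.
move=> oA oB; rewrite openE => z [Az Bz].
exists (A, B) => //=; split; exact: open_nbhs_nbhs.
Qed.

Lemma prod_second_countable : @second_countable MN.
Proof.
have [B1 cB1 [oB1 bB1]] := m_second_countable M.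
have [B2 cB2 [oB2 bB2]] := m_second_countable N.
exists ((fun UV : set M * set N => UV.1 `*` UV.2) @` (B1 `*` B2)).
  by apply: sub_countable (card_image_le _ _) _; exact: countableX.
split.
  by move=> _ [[U V] /= [/oB1 oU /oB2 oV] <-]; exact: openX.
move=> z A [[C D] /= [zC zD] CDA].
have [U [B1U Uz] UC] := bB1 _ _ zC.
have [V [B2V Vz] VD] := bB2 _ _ zD.
exists (U `*` V); first by split; [exists (U, V)|].
by move=> y [Uy Vy]; apply: CDA; split; [exact: UC|exact: VD].
Qed.

Lemma row_mx_continuous_at (T : topologicalType) (f : T -> 'rV[R]_m)
    (g : T -> 'rV[R]_n) (x : T) :
  {for x, continuous f} -> {for x, continuous g} ->
  {for x, continuous (fun y => row_mx (f y) (g y))}.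
Proof.
move=> fc gc; apply/cvg_ballP => e e0.
have /cvg_ballP/(_ e e0) nf := fc; have /cvg_ballP/(_ e e0) ng := gc.
near=> y; split => // i j.
have [_ Bf] : ball (f x) e (f y) by near: y.
have [_ Bg] : ball (g x) e (g y) by near: y.
by rewrite !mxE; case: splitP => k _.
Unshelve. all: by end_near. Qed.

Lemma pdom_open c : open (pdom c).
Proof. by apply: openX; exact: cdom_open. Qed.

Lemma pimgE c : pcrd c @` pdom c =
  (lsubmx @^-1` (crd c.1 @` cdom c.1)) `&` (rsubmx @^-1` (crd c.2 @` cdom c.2)).
Proof.
apply/seteqP; split => x /=.
  by move=> [[p q] [/= Hp Hq] <-]; rewrite row_mxKl row_mxKr; split;
     [exists p|exists q].
move=> [[p Hp Ep] [q Hq Eq]]; exists (p, q) => //.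
by rewrite /pcrd /= Ep Eq hsubmxK.
Qed.

Lemma pimg_open c : open (pcrd c @` pdom c).
Proof.
rewrite pimgE; apply: openI; apply: open_comp.
- by move=> ? _; exact: continuous_lsubmx.
- exact: cimg_open.
- by move=> ? _; exact: continuous_rsubmx.
- exact: cimg_open.
Qed.

Lemma pcrdK c p : pdom c p -> ppar c (pcrd c p) = p.
Proof.
by case: p => p q [/= Hp Hq]; rewrite /ppar row_mxKl row_mxKr !crdK.
Qed.

Lemma pcrd_continuous c p : pdom c p -> {for p, continuous (pcrd c)}.
Proof.
case: p => p q [/= Hp Hq]; apply: row_mx_continuous_at.
- apply: (continuous_comp (f := fst)); first exact: cvg_fst.
  exact: crd_continuous.
- apply: (continuous_comp (f := snd)); first exact: cvg_snd.
  exact: crd_continuous.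
Qed.

Lemma ppar_continuous c x : (pcrd c @` pdom c) x ->
  {for x, continuous (ppar c)}.
Proof.
rewrite pimgE => -[/= H1 H2].
have Hl : {for x, continuous (fun y : 'rV[R]_(m + n) => par c.1 (lsubmx y))}.
  apply: continuous_comp; first exact: continuous_lsubmx.
  exact: par_continuous.
have Hr : {for x, continuous (fun y : 'rV[R]_(m + n) => par c.2 (rsubmx y))}.
  apply: continuous_comp; first exact: continuous_rsubmx.
  exact: par_continuous.
exact: cvg_pair Hl Hr.
Qed.

Lemma pchart_cover p : exists c, pdom c p.
Proof.
by have [c Hc] := chart_cover p.1; have [d Hd] := chart_cover p.2; exists (c, d).
Qed.

Lemma lsubmx_delta (a : 'I_(m + n)) :
  (exists b, lsubmx (delta_mx 0 a) = delta_mx 0 b :> 'rV[R]_m) \/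
  lsubmx (delta_mx 0 a) = 0 :> 'rV[R]_m.
Proof.
case: (split_ordP a) => b ->; [left; exists b|right]; apply/rowP => i.
  by rewrite !mxE eq_lshift.
by rewrite !mxE eq_lrshift andbF.
Qed.

Lemma rsubmx_delta (a : 'I_(m + n)) :
  (exists b, rsubmx (delta_mx 0 a) = delta_mx 0 b :> 'rV[R]_n) \/
  rsubmx (delta_mx 0 a) = 0 :> 'rV[R]_n.
Proof.
case: (split_ordP a) => b ->; [right|left; exists b]; apply/rowP => i.
  by rewrite !mxE eq_rlshift andbF.
by rewrite !mxE eq_rshift.
Qed.

Lemma ptransition_smooth c d b :
  smooth_on (pcrd c @` (pdom c `&` pdom d)) (fun x => pcrd d (ppar c x) 0 b).
Proof.
move=> k; rewrite /pcrd /ppar /=; case: (split_ordP b) => i ->.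
- have -> : (fun x : 'rV[R]_(m + n) =>
      row_mx (crd d.1 (par c.1 (lsubmx x))) (crd d.2 (par c.2 (rsubmx x)))
        0 (lshift n i)) =
      (fun y => crd d.1 (par c.1 y) 0 i) \o lsubmx.
    by apply/funext => x; rewrite row_mxEl.
  apply: Ck_lin (transition_smooth c.1 d.1 i k).
  + exact: linearP.
  + exact: continuous_lsubmx.
  + exact: lsubmx_delta.
  + by move=> _ [[p q] [[/= H1 _] [/= H2 _]] <-]; rewrite row_mxKl; exists p.
- have -> : (fun x : 'rV[R]_(m + n) =>
      row_mx (crd d.1 (par c.1 (lsubmx x))) (crd d.2 (par c.2 (rsubmx x)))
        0 (rshift m i)) =
      (fun y => crd d.2 (par c.2 y) 0 i) \o rsubmx.
    by apply/funext => x; rewrite row_mxEr.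
  apply: Ck_lin (transition_smooth c.2 d.2 i k).
  + exact: linearP.
  + exact: continuous_rsubmx.
  + exact: rsubmx_delta.
  + by move=> _ [[p q] [[/= _ H1] [/= _ H2]] <-]; rewrite row_mxKr; exists q.
Qed.

Definition prod_manifold : manifold R (m + n) :=
  Manifold prod_hausdorff prod_second_countable pdom_open pimg_open pcrdK
    pcrd_continuous ppar_continuous pchart_cover ptransition_smooth.

End ProductManifold.

Section RealLine.
Variable R : realType.

Let lcrd (_ : unit) (t : R) : 'rV[R]_1 := const_mx t.
Let lpar (_ : unit) (x : 'rV[R]_1) : R := x 0 0.

Lemma line_second_countable : @second_countable R.
Proof.
exists ((fun ab : rat * rat => [set` `]ratr ab.1 : R, ratr ab.2[]) @` setT).
  by apply: sub_countable (card_image_le _ _) _; exact: countableP.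
split; first by move=> _ [[a b] _ <-]; exact: interval_open.
move=> x A /nbhs_ballP [e /= e0 eA].
have [a] : exists q : rat, ratr q \in `]x - e, x[.
  by apply: rat_in_itvoo; rewrite ltrBlDr ltrDl.
have [b] : exists q : rat, ratr q \in `]x, x + e[.
  by apply: rat_in_itvoo; rewrite ltrDl.
rewrite !in_itv /= => /andP[xb be] /andP[ea ax].
exists [set` `]ratr a : R, ratr b[].
  by split; [exists (a, b)|rewrite /= in_itv /= ax].
move=> y /=; rewrite in_itv /= => /andP[ay yb]; apply: eA.
rewrite /ball /= ltr_distlC.
by rewrite (lt_trans ea ay) (lt_trans yb be).
Qed.

Lemma limgE c : lcrd c @` setT = setT.
Proof.
apply/seteqP; split => // x _; exists (x 0 0) => //.
by apply/rowP => i; rewrite mxE (ord1 i).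
Qed.

Lemma limg_open c : open (lcrd c @` setT).
Proof. by rewrite limgE; exact: openT. Qed.

Lemma lcrdK c (t : R) : setT t -> lpar c (lcrd c t) = t.
Proof. by move=> _; rewrite /lpar /lcrd mxE. Qed.

Lemma lcrd_continuous c (t : R) : setT t -> {for t, continuous (lcrd c)}.
Proof.
move=> _; apply/cvg_ballP => e e0.
by apply: filterS (nbhsx_ballx t e e0) => s ts; split => // i j; rewrite /lcrd !mxE.
Qed.

Lemma lpar_continuous c (x : 'rV[R]_1) : (lcrd c @` setT) x ->
  {for x, continuous (lpar c)}.
Proof. by move=> _; exact: coord_continuous. Qed.

Lemma lchart_cover (t : R) : exists c : unit, [set: R] t.
Proof. by exists tt. Qed.

Lemma ltransition_smooth (c d : unit) b :
  smooth_on (lcrd c @` (setT `&` setT)) (fun x => lcrd d (lpar c x) 0 b).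
Proof.
have -> : (fun x => lcrd d (lpar c x) 0 b) = (fun x : 'rV[R]_1 => x 0 0).
  by apply/funext => x; rewrite mxE.
have cx (x : 'rV[R]_1) : {for x, continuous (fun x : 'rV[R]_1 => x 0 0)}.
  exact: coord_continuous.
have dx : 'D_(delta_mx 0 0) (fun x : 'rV[R]_1 => x 0 0) = cst 1.
  apply/funext => x; rewrite deriveE; last exact: differentiable_coord.
  have lin : linear (fun x : 'rV[R]_1 => x 0 0) by move=> ? ? ?; rewrite !mxE.
  pose fM := GRing.isLinear.Build _ _ _ _ _ lin.
  pose f : {linear 'rV[R]_1 -> R} := HB.pack (fun x : 'rV[R]_1 => x 0 0) fM.
  rewrite (_ : (fun _ => _) = f) // diff_lin; last exact: coord_continuous.
  by rewrite /= mxE.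
case=> [|k]; split => //.
move=> a; rewrite (ord1 a); split.
  by move=> x _; apply: diff_derivable; exact: differentiable_coord.
by rewrite dx; exact: Ck_cst.
Qed.

Definition real_line : manifold R 1 :=
  @Manifold R 1 R (@Rhausdorff R) line_second_countable unit (fun=> setT)
    lcrd lpar (fun=> openT) limg_open lcrdK lcrd_continuous lpar_continuous
    lchart_cover ltransition_smooth.

End RealLine.

(* A tensor field on [M] is the family of its component arrays
   [chart M -> M -> _]: the value at [c] and [p] holds the components at [p]
   in the coordinates of [c], and is meaningful only when [cdom c p].
   Vectors, covectors and elements [(X, alpha)] of the generalized tangent
   bundle are row vectors, and a bundle map is the matrix [A] acting by
   [u |-> u *m A]; so the composition of [A] followed by [B] is [A *m B]. *)

Section TensorFields.
Variables (R : realType) (n : nat) (M : manifold R n).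

Definition field (T : Type) := chart M -> M -> T.
Definition vfield := field 'rV[R]_n.
Definition oneform := field 'rV[R]_n.
(* [omega c p] has the entries [omega(d_a, d_b)]: it is the matrix of
   [X |-> iota_X omega] *)
Definition twoform := field 'M[R]_n.
(* matrix of the associated map from covectors to vectors *)
Definition bivector := field 'M[R]_n.
Definition gfield := field 'rV[R]_(n + n).
Definition gendo := field 'M[R]_(n + n).

Definition smooth_fun (c : chart M) (f : M -> R) : Prop :=
  smooth_on (crd c @` cdom c) (f \o par c).

Definition pd (c : chart M) (a : 'I_n) (f : M -> R) (p : M) : R :=
  'D_(delta_mx 0 a) (f \o par c) (crd c p).

Definition jac (c d : chart M) (p : M) : 'M[R]_n :=
  jacobian (crd d \o par c) (crd c p).

(* transition matrix of the generalized tangent bundle: vectors transform by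
   the Jacobian of the coordinate change, covectors by its inverse transpose *)
Definition gjac (c d : chart M) (p : M) : 'M[R]_(n + n) :=
  block_mx (jac c d p) 0 0 (jac d c p)^T.

Definition is_gsection (u : gfield) : Prop :=
  (forall c d p, cdom c p -> cdom d p -> u d p = u c p *m gjac c d p) /\
  (forall c k, smooth_fun c (fun p => u c p 0 k)).

Definition is_gendo (A : gendo) : Prop :=
  (forall c d p, cdom c p -> cdom d p ->
     A c p *m gjac c d p = gjac c d p *m A d p) /\
  (forall c k l, smooth_fun c (fun p => A c p k l)).

Definition prT (u : gfield) : vfield := fun c p => lsubmx (u c p).
Definition prT' (u : gfield) : oneform := fun c p => rsubmx (u c p).

Definition covec_app (alpha X : 'rV[R]_n) : R := \sum_a alpha 0 a * X 0 a.

Definition lie_bracket (X Y : vfield) : vfield := fun c p =>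
  \row_a \sum_b (X c p 0 b * pd c b (fun q => Y c q 0 a) p
                 - Y c p 0 b * pd c b (fun q => X c q 0 a) p).

Definition lie_derivative (X : vfield) (alpha : oneform) : oneform := fun c p =>
  \row_a \sum_b (X c p 0 b * pd c b (fun q => alpha c q 0 a) p
                 + alpha c p 0 b * pd c a (fun q => X c q 0 b) p).

Definition dfun (f : field R) : oneform := fun c p => \row_a pd c a (f c) p.

Definition dform (alpha : oneform) : twoform := fun c p =>
  \matrix_(a, b) (pd c a (fun q => alpha c q 0 b) p
                 - pd c b (fun q => alpha c q 0 a) p).

Definition courant (u v : gfield) : gfield := fun c p =>
  row_mx (lie_bracket (prT u) (prT v) c p)
    (lie_derivative (prT u) (prT' v) c p - lie_derivative (prT v) (prT' u) c p
     - 2^-1 *: dfun (fun d q => covec_app (prT' v d q) (prT u d q)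
                              - covec_app (prT' u d q) (prT v d q)) c p).

(* [iota_alpha (X /\ Y) = alpha(X) Y - alpha(Y) X] *)
Definition wedge_vec (X Y : vfield) : bivector := fun c p =>
  (X c p)^T *m Y c p - (Y c p)^T *m X c p.

(* the composition [B pi], mapping [alpha] to [B (pi alpha)] *)
Definition form_biv (B : twoform) (P : bivector) : field 'M[R]_n :=
  fun c p => P c p *m B c p.

(* Each [A c p] is the matrix of an endomorphism of the cotangent space at
   [p] in the coordinates of [c] *)
Definition one_plus_invertible (A : field 'M[R]_n) : Prop :=
  forall c p, cdom c p -> 1%:M + A c p \in unitmx.

End TensorFields.

Section Fibre.
Variables (R : realType) (n : nat).
Implicit Types (u v : 'rV[R]_(n + n)) (A : 'M[R]_(n + n)).

Definition gpair u v : R :=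
  2^-1 * (covec_app (rsubmx v) (lsubmx u) + covec_app (rsubmx u) (lsubmx v)).

Definition is_adjoint A A' : Prop :=
  forall u v, gpair (u *m A) v = gpair u (v *m A').

Definition gtensor E F u : 'rV[R]_(n + n) := (2 * gpair F u) *: E.

End Fibre.

Record gcm_data (R : realType) (n : nat) (M : manifold R n) := GcmData {
  Phi : gendo M;
  Ep : gfield M;
  Em : gfield M;
  gmetric : gendo M
}.

Section GeneralizedContact.
Variables (R : realType) (n : nat) (M : manifold R n) (S : gcm_data M).

Local Notation Phi := (Phi S).
Local Notation Ep := (Ep S).
Local Notation Em := (Em S).
Local Notation G := (gmetric S).

Definition gen_almost_contact : Prop :=
  [/\ is_gendo Phi, is_gsection Ep, is_gsection Em &
   forall c p, cdom c p ->
   [/\ is_adjoint (Phi c p) (- Phi c p),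
       forall u, u *m Phi c p *m Phi c p =
         - u + gtensor (Ep c p) (Em c p) u + gtensor (Em c p) (Ep c p) u,
       gpair (Ep c p) (Ep c p) = 0, gpair (Em c p) (Em c p) = 0 &
       2 * gpair (Ep c p) (Em c p) = 1]].

(* The Courant bracket is extended complex bilinearly to complex sections,
   which are smooth when their real and imaginary parts are *)
Definition cgfield := field M 'rV[R[i]]_(n + n).
Definition re_field (u : cgfield) : gfield M :=
  fun c p => map_mx (@complex.Re R) (u c p).
Definition im_field (u : cgfield) : gfield M :=
  fun c p => map_mx (@complex.Im R) (u c p).
Definition is_cgsection (u : cgfield) : Prop :=
  is_gsection (re_field u) /\ is_gsection (im_field u).
Definition ccourant (u v : cgfield) : cgfield := fun c p =>
  \row_k Complex
    (courant (re_field u) (re_field v) c p 0 k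
     - courant (im_field u) (im_field v) c p 0 k)
    (courant (re_field u) (im_field v) c p 0 k
     + courant (im_field u) (re_field v) c p 0 k).

Definition eigen10 (c : chart M) (p : M) (w : 'rV[R[i]]_(n + n)) : Prop :=
  w *m map_mx (real_complex R) (Phi c p) = 'i%C *: w.

Definition in_L (E : gfield M) (c : chart M) (p : M) (u : 'rV[R[i]]_(n + n))
  : Prop :=
  exists z w, eigen10 c p w /\ u = z *: map_mx (real_complex R) (E c p) + w.

Definition L_closed (E : gfield M) : Prop :=
  forall u v : cgfield, is_cgsection u -> is_cgsection v ->
    (forall c p, cdom c p -> in_L E c p (u c p)) ->
    (forall c p, cdom c p -> in_L E c p (v c p)) ->
    forall c p, cdom c p -> in_L E c p (ccourant u v c p).

Definition strong : Prop := L_closed Ep /\ L_closed Em.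

Definition normal_gen_contact : Prop :=
  [/\ gen_almost_contact, strong &
      forall c p, cdom c p -> courant Ep Em c p = 0].

Definition gen_metric : Prop :=
  is_gendo G /\
  forall c p, cdom c p ->
  [/\ is_adjoint (G c p) (G c p), G c p *m G c p = 1%:M &
      forall u, u != 0 -> 0 < gpair (u *m G c p) u].

Definition metric_compatible : Prop :=
  forall c p, cdom c p -> forall u,
    - (u *m Phi c p *m G c p *m Phi c p) =
    u *m G c p - gtensor (Ep c p) (Ep c p) u - gtensor (Em c p) (Em c p) u.

Definition normal_gcm : Prop :=
  [/\ normal_gen_contact, gen_metric & metric_compatible].

(* In the row convention the block [dlsubmx (Phi c p)] is the matrix of
   [alpha |-> pr_T (Phi alpha)], i.e. of [pi_0] *)
Definition canonical_poisson : bivector M := fun c p =>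
  dlsubmx (Phi c p) + wedge_vec (prT Ep) (prT Em) c p.

Definition contact_form : oneform M := fun c p => prT' Ep c p + prT' Em c p.

End GeneralizedContact.

Definition line_gcm (R : realType) : gcm_data (real_line R) :=
  {| Phi := fun _ _ => 0;
     Ep := fun _ _ => row_mx 0 (const_mx 1);
     Em := fun _ _ => row_mx (const_mx 1) 0;
     gmetric := fun _ _ => block_mx 0 1%:M 1%:M 0 |}.

Section LineNormal.
Variable R : realType.
Local Notation L := (real_line R).

Lemma pd_cst n (M : manifold R n) c a (k : R) (p : M) : pd c a (fun=> k) p = 0.
Proof. exact: derive_cst. Qed.

Lemma smooth_fun_cst n (M : manifold R n) c (k : R) :
  @smooth_fun R n M c (fun=> k).
Proof. by move=> j; exact: Ck_cst. Qed.

Lemma line_gjac (c d : chart L) (p : L) : gjac c d p = 1%:M.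
Proof.
have J (c' d' : chart L) : jac c' d' p = 1%:M.
  rewrite /jac.
  have -> : crd d' \o par c' = idfun :> ('rV[R]_1 -> 'rV[R]_1).
    by apply/funext => x; apply/rowP => i; rewrite /= mxE (ord1 i).
  have dE (x : 'rV[R]_1) : 'd idfun x = idfun :> ('rV[R]_1 -> 'rV[R]_1).
    by apply: diff_lin => y; exact: cvg_id.
  apply/matrixP => i j; rewrite /jacobian mxE dE /= !mxE (ord1 i) (ord1 j).
  by rewrite eqxx.
by rewrite /gjac !J trmx1 -scalar_mx_block.
Qed.

Lemma in_L_line (E : gfield L) (c : chart L) (p : L) u :
  in_L (line_gcm R) E c p u <->
  exists z, u = z *: map_mx (real_complex R) (E c p).
Proof.
split=> [[z [w [wE ->]]]|[z ->]]; last first.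
  exists z, 0; split; last by rewrite addr0.
  by rewrite /eigen10 mul0mx scaler0.
exists z; suff -> : w = 0 by rewrite addr0.
move: wE; rewrite /eigen10 /= map_mx0 mulmx0 => /esym/eqP.
rewrite scaler_eq0 => /orP[|/eqP//].
by rewrite eq_complex /= oner_eq0 andbF.
Qed.

Lemma lie_bracket00 n (M : manifold R n) c p :
  @lie_bracket R n M (fun _ _ => 0) (fun _ _ => 0) c p = 0.
Proof.
by apply/rowP => a; rewrite !mxE big1 // => b _; rewrite !mxE !mul0r subrr.
Qed.

Lemma lie_derivative0l n (M : manifold R n) (w : oneform M) c p :
  @lie_derivative R n M (fun _ _ => 0) w c p = 0.
Proof.
apply/rowP => a; rewrite !mxE big1 // => b _.
by rewrite pd_cst !mxE mul0r mulr0 addr0.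
Qed.

Lemma lie_derivative0r n (M : manifold R n) (X : vfield M) c p :
  lie_derivative X (fun _ _ => 0) c p = 0.
Proof.
apply/rowP => a; rewrite !mxE big1 // => b _.
by rewrite pd_cst !mxE mul0r mulr0 addr0.
Qed.

Lemma covec_app0l n (X : 'rV[R]_n) : covec_app 0 X = 0.
Proof. by rewrite /covec_app big1 // => a _; rewrite mxE mul0r. Qed.

Lemma covec_app0r n (X : 'rV[R]_n) : covec_app X 0 = 0.
Proof. by rewrite /covec_app big1 // => a _; rewrite mxE mulr0. Qed.

Lemma courant_forms n (M : manifold R n) (u v : gfield M) c p :
  prT u = (fun _ _ => 0) -> prT v = (fun _ _ => 0) -> courant u v c p = 0.
Proof.
move=> u0 v0; rewrite /courant u0 v0 lie_bracket00 // !lie_derivative0l subrr.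
rewrite [dfun _ _ _](_ : _ = 0) ?scaler0 ?subrr ?row_mx0 //.
apply/rowP => a; rewrite !mxE.
rewrite [X in pd _ _ X](_ : _ = fun=> 0) ?pd_cst //.
by apply/funext => q; rewrite !covec_app0r subrr.
Qed.

Lemma courant_vectors n (M : manifold R n) (u v : gfield M) c p :
  prT' u = (fun _ _ => 0) -> prT' v = (fun _ _ => 0) ->
  rsubmx (courant u v c p) = 0.
Proof.
move=> u0 v0; rewrite /courant u0 v0 row_mxKr !lie_derivative0r subrr.
rewrite [dfun _ _ _](_ : _ = 0) ?scaler0 ?subrr //.
apply/rowP => a; rewrite !mxE.
rewrite [X in pd _ _ X](_ : _ = fun=> 0) ?pd_cst //.
by apply/funext => q; rewrite !covec_app0l subrr.
Qed.

Lemma courant_cst n (M : manifold R n) (x y : 'rV[R]_(n + n)) c p :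
  @courant R n M (fun _ _ => x) (fun _ _ => y) c p = 0.
Proof.
rewrite /courant /prT /prT' -[RHS]row_mx0; congr row_mx.
  by apply/rowP => a; rewrite !mxE big1 // => b _; rewrite !pd_cst !mulr0 subrr.
have lie0 (X w : 'rV[R]_n) :
    @lie_derivative R n M (fun _ _ => X) (fun _ _ => w) c p = 0.
  apply/rowP => a; rewrite !mxE big1 // => b _.
  by rewrite !pd_cst !mulr0 addr0.
rewrite !lie0 subrr sub0r; apply/rowP => a.
by rewrite !mxE pd_cst mulr0 oppr0.
Qed.

Lemma line_is_gsection (x : 'rV[R]_(1 + 1)) :
  @is_gsection R 1 L (fun _ _ => x).
Proof.
split; first by move=> c d p _ _; rewrite line_gjac mulmx1.
by move=> c k; exact: smooth_fun_cst.
Qed.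

Lemma line_is_gendo (A : 'M[R]_(1 + 1)) : @is_gendo R 1 L (fun _ _ => A).
Proof.
split; first by move=> c d p _ _; rewrite line_gjac mulmx1 mul1mx.
by move=> c k l; exact: smooth_fun_cst.
Qed.

Lemma line_gen_almost_contact : gen_almost_contact (line_gcm R).
Proof.
have c1 (x y : 'rV[R]_1) : covec_app x y = x 0 0 * y 0 0.
  by rewrite /covec_app big_ord1.
split; [exact: line_is_gendo|exact: line_is_gsection|exact: line_is_gsection|].
move=> c p _ /=; split.
- move=> u v; rewrite oppr0 !mulmx0 /gpair !linear0.
  by rewrite !covec_app0l !covec_app0r !addr0.
- move=> u; rewrite -[u]hsubmxK; move: (lsubmx u) (rsubmx u) => x y.
  have k1 (z : 'rV[R]_1) : z = z 0 0 *: const_mx 1.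
    by apply/rowP => i; rewrite !mxE mulr1 (ord1 i).
  rewrite !mulmx0 /gtensor /gpair !row_mxKl !row_mxKr !c1 !mxE.
  rewrite ?(mulr0, mul0r, mulr1, mul1r, addr0, add0r) !mulrA.
  rewrite !mulfV ?mul1r ?pnatr_eq0 // !scale_row_mx !scaler0 -!k1.
  by rewrite opp_row_mx !add_row_mx !addr0 !addNr row_mx0.
- by rewrite /gpair !row_mxKl !covec_app0r addr0 mulr0.
- by rewrite /gpair !row_mxKr !covec_app0l addr0 mulr0.
- rewrite /gpair !row_mxKl !row_mxKr !c1 !mxE mulr0 mulr1 add0r mulr1.
  by rewrite mulfV // pnatr_eq0.
Qed.

Lemma line_strong : strong (line_gcm R).
Proof.
split=> u v us vs uL vL c p _; apply/in_L_line.
- have P0 (w : cgfield L) :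
    (forall c p, cdom c p -> in_L (line_gcm R) (Ep (line_gcm R)) c p (w c p)) ->
    prT (re_field w) = (fun _ _ => 0) /\ prT (im_field w) = (fun _ _ => 0).
    move=> wL; split; apply/funext => d; apply/funext => q;
    rewrite /prT /re_field /im_field; have /in_L_line [z ->] := wL d q I;
    rewrite map_row_mx map_mx0 scale_row_mx scaler0 map_row_mx row_mxKl;
    by apply/rowP => i; rewrite !mxE.
  have [ur ui] := P0 u uL; have [vr vi] := P0 v vL.
  exists 0; rewrite scale0r; apply/rowP => k.
  by rewrite /ccourant mxE !courant_forms // !mxE subrr addr0.
- have P0 (w : cgfield L) :
    (forall c p, cdom c p -> in_L (line_gcm R) (Em (line_gcm R)) c p (w c p)) ->
    prT' (re_field w) = (fun _ _ => 0) /\ prT' (im_field w) = (fun _ _ => 0).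
    move=> wL; split; apply/funext => d; apply/funext => q;
    rewrite /prT' /re_field /im_field; have /in_L_line [z ->] := wL d q I;
    rewrite map_row_mx map_mx0 scale_row_mx scaler0 map_row_mx row_mxKr;
    by apply/rowP => i; rewrite !mxE.
  have [ur ui] := P0 u uL; have [vr vi] := P0 v vL.
  exists (ccourant u v c p 0 0); apply/rowP => k.
  case: (split_ordP k) => j ->; rewrite (ord1 j).
    rewrite map_row_mx scale_row_mx row_mxEl [RHS]mxE map_const_mx.
    by rewrite [const_mx _ _ _]mxE mulr1; congr (ccourant _ _ _ _ _ _); exact: val_inj.
  have c0 (f g : gfield L) : prT' f = (fun _ _ => 0) -> prT' g = (fun _ _ => 0) ->
      courant f g c p 0 (rshift 1 0) = 0.
    move=> f0 g0; have /rowP/(_ 0) := courant_vectors c p f0 g0.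
    by rewrite !mxE.
  rewrite map_row_mx map_mx0 scale_row_mx scaler0 row_mxEr /ccourant mxE.
  by rewrite !c0 // subrr addr0 mxE.
Qed.

Lemma line_gen_metric : gen_metric (line_gcm R).
Proof.
have c1 (x y : 'rV[R]_1) : covec_app x y = x 0 0 * y 0 0.
  by rewrite /covec_app big_ord1.
split; first exact: line_is_gendo.
move=> c p _ /=; split.
- move=> u v; rewrite -[u]hsubmxK -[v]hsubmxK.
  move: (lsubmx u) (rsubmx u) (lsubmx v) (rsubmx v) => x y z w.
  rewrite !mul_row_block !mulmx0 !mulmx1 !add0r !addr0.
  rewrite /gpair !row_mxKl !row_mxKr !c1; congr (_ * _).
  by rewrite mulrC [RHS]addrC; congr (_ + _); rewrite mulrC.
- rewrite mulmx_block !mulmx0 !mul0mx !mulmx1 !add0r !addr0.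
  by rewrite -scalar_mx_block.
- move=> u; rewrite -[u]hsubmxK; move: (lsubmx u) (rsubmx u) => x y xy0.
  rewrite mul_row_block !mulmx0 !mulmx1 !add0r !addr0.
  rewrite /gpair !row_mxKl !row_mxKr !c1 pmulr_rgt0 ?invr_gt0 ?ltr0n //.
  rewrite lt_neqAle addr_ge0 -?expr2 ?sqr_ge0 // andbT eq_sym.
  rewrite paddr_eq0 ?sqr_ge0 // !sqrf_eq0; apply: contra xy0 => /andP[/eqP a /eqP b].
  apply/eqP; rewrite -[RHS]row_mx0; congr row_mx; apply/rowP => i;
  by rewrite (ord1 i) mxE.
Qed.

Lemma line_metric_compatible : metric_compatible (line_gcm R).
Proof.
have c1 (x y : 'rV[R]_1) : covec_app x y = x 0 0 * y 0 0.
  by rewrite /covec_app big_ord1.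
have k1 (z : 'rV[R]_1) : z = z 0 0 *: const_mx 1.
  by apply/rowP => i; rewrite !mxE mulr1 (ord1 i).
move=> c p _ u /=; rewrite -[u]hsubmxK; move: (lsubmx u) (rsubmx u) => x y.
rewrite mul_row_block !mulmx0 !mulmx1 !add0r !addr0 oppr0.
rewrite /gtensor /gpair !row_mxKl !row_mxKr !c1 !mxE.
rewrite ?(mulr0, mul0r, mulr1, mul1r, addr0, add0r) !mulrA.
rewrite !mulfV ?mul1r ?pnatr_eq0 // !scale_row_mx !scaler0 -!k1.
by rewrite !opp_row_mx !add_row_mx oppr0 !addr0 !subrr row_mx0.
Qed.

Lemma line_normal_gcm : normal_gcm (line_gcm R).
Proof.
split; [split|exact: line_gen_metric|exact: line_metric_compatible].
- exact: line_gen_almost_contact.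
- exact: line_strong.
move=> c p _; exact: courant_cst.
Qed.
End LineNormal.

Section ProductFields.
Variables (R : realType) (m n : nat) (M : manifold R m) (N : manifold R n).

Definition pull1 (alpha : oneform M) : oneform (prod_manifold M N) :=
  fun c p => row_mx (alpha c.1 p.1) 0.

Definition prod_bivector (P : bivector M) (Q : bivector N) :
  bivector (prod_manifold M N) :=
  fun c p => block_mx (P c.1 p.1) 0 0 (Q c.2 p.2).

End ProductFields.

(* Main.v *)
Require Import Defs.
From mathcomp Require Import all_boot all_order all_algebra.
From mathcomp Require Import all_classical all_reals all_analysis.

Set Implicit Arguments.
Unset Strict Implicit.
Unset Printing Implicit Defensive.

Import Order.TTheory GRing.Theory Num.Theory.
Import numFieldNormedType.Exports.

Local Open Scope classical_set_scope.
Local Open Scope ring_scope.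

(** The bivector on [M * R] is [pi_M] padded by zeros, since the canonical
    Poisson structure of the line vanishes. With [B = d(e^t eta)] written in
    blocks along [M] and along the line, [I + B pi] is therefore block
    triangular with lower right block [1], and its determinant is that of the
    upper left block. There only the [M]-directions of [B] occur; [e^t] is
    constant along them, so this block is [I + e^t Bhat pi_M] at the point [p]
    for the given [t] ([dform_scale_pull1], [unitmx_add1_prod]).

    Hence [I + B pi] is invertible at [(p, t)] exactly when [I + e^t Bhat pi_M]
    is invertible at [p]; quantifying over [t] gives the equivalence. *)

(** Moving in a direction of the first factor leaves [q.2] fixed, so [g q.2]
    factors out of the difference quotient as a constant. *)
Lemma pd_prod_lshift (R : realType) (m n : nat) (M : manifold R m)
    (N : manifold R n) (c : chart (prod_manifold M N)) (p : prod_manifold M N)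
    (a : 'I_m) (g : N -> R) (f : M -> R) :
  cdom c p ->
  derivable (f \o par c.1) (crd c.1 p.1) (delta_mx 0 a) ->
  pd c (lshift n a) (fun q : prod_manifold M N => g q.2 * f q.1) p =
  g p.2 * pd c.1 a f p.1.
Proof.
case: c p => [c d] [p q] /= [/= cp dq] df.
rewrite /pd -[RHS]/(g q *: 'D_(delta_mx 0 a) (f \o par c) (crd c p)).
rewrite -deriveZ // /derive.
apply: (congr1 (fun k : R -> R => lim (k @ 0^'))); apply/funext => h.
congr (_ *: _).
rewrite /= !linearP /= !row_mxKl !row_mxKr.
have -> : lsubmx (delta_mx 0 (lshift n a) : 'rV[R]_(m + n)) = delta_mx 0 a.
  by apply/rowP => i; rewrite !mxE eq_lshift.
have -> : rsubmx (delta_mx 0 (lshift n a) : 'rV[R]_(m + n)) = 0.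
  by apply/rowP => i; rewrite !mxE eq_rlshift andbF.
by rewrite scaler0 add0r (crdK dq).
Qed.

Lemma dform_scale_pull1 (R : realType) (m n : nat) (M : manifold R m)
    (N : manifold R n) (alpha : oneform M) (g : N -> R)
    (c : chart (prod_manifold M N)) (p : prod_manifold M N) :
  cdom c p ->
  (forall a b, derivable ((fun q => alpha c.1 q 0 b) \o par c.1)
                 (crd c.1 p.1) (delta_mx 0 a)) ->
  ulsubmx (dform (fun c (p : prod_manifold M N) => g p.2 *: pull1 alpha c p) c p
    : 'M[R]_(m + n)) =
  g p.2 *: dform alpha c.1 p.1.
Proof.
move=> cp dalpha; apply/matrixP => a b; rewrite !mxE.
have entry i : (fun q : prod_manifold M N =>
    (g q.2 *: pull1 alpha c q) 0 (lshift n i)) =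
    (fun q => g q.2 * alpha c.1 q.1 0 i).
  by apply/funext => q; rewrite mxE row_mxEl.
have pdE i j := pd_prod_lshift g cp (dalpha i j).
by rewrite !entry !pdE mulrBr.
Qed.

Lemma unitmx_add1_prod (R : realType) (m n : nat) (P Q : 'M[R]_m)
    (B : 'M[R]_(m + n)) :
  ulsubmx B = Q ->
  (1%:M + block_mx P 0 0 0 *m B \in unitmx) = (1%:M + P *m Q \in unitmx).
Proof.
move=> <-; rewrite -[X in _ *m X]submxK mulmx_block !mul0mx !addr0.
rewrite scalar_mx_block add_block_mx !addr0 add0r.
by rewrite !unitmxE det_ublock det1 mulr1.
Qed.

Lemma line_canonical_poisson (R : realType) c p :
  canonical_poisson (line_gcm R) c p = 0.
Proof.
rewrite /canonical_poisson /wedge_vec /prT /= row_mxKl trmx0 mul0mx mulmx0.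
by rewrite subrr addr0; apply/matrixP => i j; rewrite !mxE.
Qed.

(** Smoothness of [E_+] and [E_-] is what lets the constant [e^t] be pulled
    out of the derivatives in [d(e^t eta)]. *)
Lemma contact_form_derivable (R : realType) (n : nat) (M : manifold R n)
    (S : gcm_data M) (c : chart M) (p : M) (a b : 'I_n) :
  gen_almost_contact S -> cdom c p ->
  derivable ((fun q => contact_form S c q 0 b) \o par c) (crd c p)
    (delta_mx 0 a).
Proof.
move=> [_ [_ smEp] [_ smEm] _] cp.
have img : (crd c @` cdom c) (crd c p) by exists p.
have -> : (fun q => contact_form S c q 0 b) \o par c =
    ((fun q => Ep S c q 0 (rshift n b)) \o par c) +
    ((fun q => Em S c q 0 (rshift n b)) \o par c).
  by apply/funext => x; rewrite /= !mxE.
have [_ /(_ a) [dEp _]] := smEp c (rshift n b) 1%N.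
have [_ /(_ a) [dEm _]] := smEm c (rshift n b) 1%N.
by apply: derivableD; [exact: dEp|exact: dEm].
Qed.

Theorem theorem5p1 (R : realType) (n : nat) (M : manifold R n)
    (S : gcm_data M) (S_normal : normal_gcm S) :
  let MR := prod_manifold M (real_line R) in
  let pi_M := canonical_poisson S in
  let pi_MR : bivector MR := prod_bivector pi_M (canonical_poisson (line_gcm R)) in
  let eta := contact_form S in
  let B : twoform MR := dform (fun c (p : MR) => expR p.2 *: pull1 eta c p) in
  let Bhat : twoform M := dform eta in
  one_plus_invertible (form_biv B pi_MR) <->
  forall t : R,
    one_plus_invertible (form_biv (fun c p => expR t *: Bhat c p) pi_M).
Proof.
move=> MR pi_M pi_MR eta B Bhat.
have [[contact _ _] _ _] := S_normal.
have pointwise (c : chart MR) (p : MR) : cdom c p ->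
    (1%:M + form_biv B pi_MR c p \in unitmx) =
    (1%:M + pi_M c.1 p.1 *m (expR p.2 *: Bhat c.1 p.1) \in unitmx).
  move=> cp; rewrite /form_biv /pi_MR /prod_bivector line_canonical_poisson.
  apply: unitmx_add1_prod; apply: dform_scale_pull1 => // a b.
  by apply: contact_form_derivable => //; case: cp.
split=> [inv t c p cp | inv c p cp].
  by rewrite -(pointwise (c, tt) (p, t)) //; apply: inv.
by rewrite pointwise //; apply: inv; case: cp.
Qed.
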